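(* Let $f\colon D\to\mathbb{R}$ be a $C^3$ function defined in an open disk $D\subset\mathbb{R}^2$. The following two conditions are equivalent: (1) The tangent plane to the graph of $f$ at a generic point is tangent to the graph along at least one straight line segment passing through the point. (2) For each $(x,y)\in D$ we have $f_{xx}f_{yy}-f_{xy}^2=0$ (i.e., the graph has vanishing Gaussian curvature).
   Context: A subset is called negligible if it is a countable union of subsets such that the closure of each one has no interior points. An assertion holds at a generic point if it holds outside a negligible set (points of the graph of $f$ are identified with points of $D$ by vertical projection). A straight line segment passing through a point $(x,y,z)$ is a nondegenerate segment of the form $(x+ut,y+vt,z+wt)$, $t\in(-\epsilon,\epsilon)$, with $\epsilon>0$ and fixed $u,v,w\in\mathbb{R}$; a plane is tangent to the graph along the segment if the segment is contained in the graph and the plane is the tangent plane to the graph at each point of the segment. *)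

(* Defs.v *)
From Stdlib Require Import Reals.
From Coquelicot Require Import Coquelicot.

Open Scope R_scope.

Definition point2 : Type := (R * R)%type.
Definition point3 : Type := (R * R * R)%type.

Definition closure {T : UniformSpace} (A : T -> Prop) (x : T) : Prop :=
  forall U : T -> Prop, locally x U -> exists y : T, U y /\ A y.

Definition interior_point {T : UniformSpace} (A : T -> Prop) (x : T) : Prop :=
  locally x A.

(* Finite unions are covered: some of the [F n] may be empty. *)
Definition negligible {T : UniformSpace} (A : T -> Prop) : Prop :=
  exists F : nat -> T -> Prop,
    (forall n : nat, ~ exists x : T, interior_point (closure (F n)) x) /\
    (forall x : T, A x <-> exists n : nat, F n x).

(* Closures are taken in the whole space [T]. For an open domain [D] this gives
   the same notion as the relative topology of [D]. *)
Definition at_generic_point {T : UniformSpace} (D P : T -> Prop) : Prop :=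
  exists N : T -> Prop,
    negligible N /\ forall x : T, D x -> ~ N x -> P x.

Definition open_disk (a b r : R) (p : point2) : Prop :=
  (fst p - a) ^ 2 + (snd p - b) ^ 2 < r ^ 2.

(* A function on an open set [D] is the restriction of a total [f]: since [D] is
   open, the values of [f] outside [D] do not affect derivatives on [D].
   [ex_diff_n f n x y] at every point of [D] says that all iterated partial
   derivatives of order at most [n] exist and are continuous on [D]. *)
Definition C_n_on (n : nat) (D : point2 -> Prop) (f : R -> R -> R) : Prop :=
  forall x y : R, D (x, y) -> ex_diff_n f n x y.

Definition graph (D : point2 -> Prop) (f : R -> R -> R) (P : point3) : Prop :=
  let '(x, y, z) := P in D (x, y) /\ z = f x y.

Definition tangent_plane (f : R -> R -> R) (x y : R) (Q : point3) : Prop :=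
  let '(X, Y, Z) := Q in
  Z = f x y + partial_derive 1 0 f x y * (X - x)
            + partial_derive 0 1 f x y * (Y - y).

Definition is_tangent_plane_at (f : R -> R -> R)
    (plane : point3 -> Prop) (P : point3) : Prop :=
  let '(x, y, _) := P in
  forall Q : point3, plane Q <-> tangent_plane f x y Q.

Definition segment_through (P : point3) (S : point3 -> Prop) : Prop :=
  let '(x, y, z) := P in
  exists (u v w : R) (eps : posreal),
    (u, v, w) <> (0, 0, 0) /\
    forall Q : point3,
      S Q <-> exists t : R,
        - eps < t < eps /\ Q = (x + u * t, y + v * t, z + w * t).

Definition tangent_along (D : point2 -> Prop) (f : R -> R -> R)
    (plane S : point3 -> Prop) : Prop :=
  (forall P : point3, S P -> graph D f P) /\
  (forall P : point3, S P -> is_tangent_plane_at f plane P).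

(* [partial_derive 1 1 f] is (f_y)_x, which agrees with (f_x)_y for C^2
   functions. *)
Definition hessian_det (f : R -> R -> R) (x y : R) : R :=
  partial_derive 2 0 f x y * partial_derive 0 2 f x y
  - (partial_derive 1 1 f x y) ^ 2.

(* Main.v *)
Require Import Defs.
From Stdlib Require Import Reals.
From Coquelicot Require Import Coquelicot.
From Stdlib Require Import Lra Lia ClassicalEpsilon.

(** If the tangent plane at a point is tangent along a segment, then the gradient
    of [f] is constant on the projected segment, so its direction lies in the
    kernel of the Hessian; by Baire's theorem the Hessian determinant then
    vanishes on a dense set, hence everywhere by continuity.

    Conversely, let the determinant vanish identically.  Where [f_xx <> 0], the
    kernel of the Hessian is spanned by [(-l, 1)] with [l = f_xy / f_xx], and
    differentiating [f_xx f_yy = f_xy^2] gives Burgers' equation [l_y = l l_x].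
    With [l0] the value of [l] at the given point, along the line of direction
    [(-l0, 1)] the difference [h = l - l0] satisfies the linear equation
    [h' = l_x h] with [h(0) = 0]; so [h = 0], and the gradient of [f] is constant
    along the line.  Where [f_yy <> 0] the coordinates are exchanged, and where
    the Hessian vanishes locally every direction will do.  The remaining points
    form the frontier of a relatively closed set, which is nowhere dense. *)

(** * Exchange of coordinates and restriction to lines *)

Lemma locally_2d_swap (P : R -> R -> Prop) (x y : R) :
  locally_2d P x y -> locally_2d (fun u v => P v u) y x.
Proof.
intros [d Hd]; exists d; intros u v Hu Hv; now apply Hd.
Qed.

Lemma differentiable_pt_lim_swap (g : R -> R -> R) (x y lx ly : R) :
  differentiable_pt_lim g x y lx ly ->
  differentiable_pt_lim (fun u v => g v u) y x ly lx.
Proof.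
intros H eps; destruct (H eps) as [d Hd]; exists d; intros u v Hu Hv.
rewrite Rmax_comm, (Rplus_comm (ly * _)); now apply Hd.
Qed.

Lemma is_derive_along_line (g : R -> R -> R) (x y u v t lx ly : R) :
  differentiable_pt_lim g (x + u * t) (y + v * t) lx ly ->
  is_derive (fun s => g (x + u * s) (y + v * s)) t (lx * u + ly * v).
Proof.
intros H; apply is_derive_Reals.
apply (derivable_pt_lim_comp_2d g (fun s => x + u * s) (fun s => y + v * s));
  [exact H | apply is_derive_Reals; auto_derive; [easy | ring] ..].
Qed.

Lemma locally_2d_along_line (P : R -> R -> Prop) (x y u v : R) :
  locally_2d P x y ->
  exists eps : posreal,
    forall t, - eps < t < eps -> P (x + u * t) (y + v * t).
Proof.
intros [d Hd].
assert (Hm : 0 < 1 + Rabs u + Rabs v)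
  by (generalize (Rabs_pos u) (Rabs_pos v); lra).
(* The summand 1 keeps the denominator positive even when [u = v = 0]; the sum bounds both [Rabs u]
   and [Rabs v]. *)
assert (He : 0 < d / (1 + Rabs u + Rabs v))
  by (apply Rdiv_lt_0_compat; [apply cond_pos | easy]).
exists (mkposreal _ He); simpl; intros t Ht.
assert (Ht' : Rabs t * (1 + Rabs u + Rabs v) < d)
  by (apply Rlt_div_r; [easy | now apply Rabs_lt_between]).
assert (Hu : 0 <= Rabs u * Rabs t) by (apply Rmult_le_pos; apply Rabs_pos).
assert (Hv : 0 <= Rabs v * Rabs t) by (apply Rmult_le_pos; apply Rabs_pos).
pose proof (Rabs_pos t).
apply Hd.
- replace (x + u * t - x) with (u * t) by ring; rewrite Rabs_mult; lra.
- replace (y + v * t - y) with (v * t) by ring; rewrite Rabs_mult; lra.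
Qed.

(** * Uniqueness for a linear differential equation *)

(** A Gronwall argument: a weighted square of [h] is nonnegative, starts at 0 and cannot increase,
    because [k - M <= 0]. *)
Lemma linear_ode_zero_right (h k : R -> R) (eps M : R) :
  (forall t, - eps < t < eps -> is_derive h t (k t * h t)) ->
  (forall t, - eps < t < eps -> k t <= M) ->
  h 0 = 0 -> forall t, 0 <= t < eps -> h t = 0.
Proof.
intros Hd Hk h0 t Ht.
(* The factor [exp (- 2 M s)] makes [phi] nonincreasing. *)
set (phi := fun s => h s ^ 2 * exp (- (2 * M * s))).
set (dphi := fun s => 2 * (k s - M) * h s ^ 2 * exp (- (2 * M * s))).
assert (Hphi : forall s, - eps < s < eps -> is_derive phi s (dphi s)).
{ intros s Hs; unfold phi, dphi; pose proof (Hd s Hs) as Hds.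
  auto_derive.
  - now exists (k s * h s).
  - rewrite (is_derive_unique h s _ Hds : Derive (fun x : R => h x) s = _); ring. }
destruct (MVT_gen phi 0 t dphi) as [c [Hc E]].
- intros s; rewrite Rmin_left, Rmax_right by lra; intros; apply Hphi; lra.
- intros s; rewrite Rmin_left, Rmax_right by lra; intros.
  apply derivable_continuous_pt; exists (dphi s).
  apply is_derive_Reals, Hphi; lra.
- rewrite Rmin_left, Rmax_right in Hc by lra.
  assert (phi 0 = 0) by (unfold phi; rewrite h0; ring).
  assert (Hle : dphi c * (t - 0) <= 0).
  { assert (0 <= h c ^ 2 * exp (- (2 * M * c)))
      by (apply Rmult_le_pos; [apply pow2_ge_0 | apply Rlt_le, exp_pos]).
    pose proof (Hk c ltac:(lra)).
    replace (dphi c * (t - 0))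
      with (- ((M - k c) * (h c ^ 2 * exp (- (2 * M * c))) * t * 2))
      by (unfold dphi; ring).
    assert (0 <= (M - k c) * (h c ^ 2 * exp (- (2 * M * c))) * t)
      by (apply Rmult_le_pos; [apply Rmult_le_pos |]; lra).
    lra. }
  change (h t ^ 2 * exp (- (2 * M * t)) - phi 0 = dphi c * (t - 0)) in E.
  pose proof (exp_pos (- (2 * M * t))) as Hexp.
  apply Rsqr_0_uniq, Rle_antisym; [| apply Rle_0_sqr].
  apply (Rmult_le_reg_r (exp (- (2 * M * t)))); [easy |].
  rewrite Rsqr_pow2, Rmult_0_l; lra.
Qed.

(** Negative times reduce to positive ones by reversing time, which replaces [k t] by [- k (- t)];
    the bound on [Rabs (k t)] serves both directions. *)
Lemma linear_ode_zero (h k : R -> R) (eps M : R) :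
  (forall t, - eps < t < eps -> is_derive h t (k t * h t)) ->
  (forall t, - eps < t < eps -> Rabs (k t) <= M) ->
  h 0 = 0 -> forall t, - eps < t < eps -> h t = 0.
Proof.
intros Hd Hk h0 t Ht.
destruct (Rle_lt_dec 0 t) as [Hp | Hn].
- apply (linear_ode_zero_right h k eps M); [easy | | easy | lra].
  intros s Hs; now apply Rabs_le_between, Hk.
- replace t with (- - t) by ring.
  apply (linear_ode_zero_right (fun s => h (- s)) (fun s => - k (- s)) eps M).
  + intros s Hs; pose proof (Hd (- s) ltac:(lra)) as Hds.
    auto_derive; [now exists (k (- s) * h (- s)) |].
    rewrite (is_derive_unique h (- s) _ Hds : Derive (fun x : R => h x) (- s) = _).
    ring.
  + intros s Hs; pose proof (Hk (- s) ltac:(lra)) as H.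
    apply Rabs_le_between in H; lra.
  + now rewrite Ropp_0.
  + lra.
Qed.

Lemma is_derive_zero_const (h : R -> R) (eps : R) :
  (forall t, - eps < t < eps -> is_derive h t 0) ->
  forall t, - eps < t < eps -> h t = h 0.
Proof.
intros Hd t Ht.
apply Rminus_diag_uniq.
apply (linear_ode_zero (fun s => h s - h 0) (fun _ => 0) eps 0).
- intros s Hs; pose proof (Hd s Hs) as Hds.
  auto_derive; [now exists 0 |].
  rewrite (is_derive_unique h s _ Hds : Derive (fun x : R => h x) s = _); ring.
- intros; rewrite Rabs_R0; lra.
- ring.
- easy.
Qed.

Lemma constant_along_line (g gx gy : R -> R -> R) (x y u v eps : R) :
  (forall t, - eps < t < eps ->
    let X := x + u * t in let Y := y + v * t in
    differentiable_pt_lim g X Y (gx X Y) (gy X Y) /\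
    gx X Y * u + gy X Y * v = 0) ->
  forall t, - eps < t < eps -> g (x + u * t) (y + v * t) = g x y.
Proof.
intros Hg t Ht.
rewrite (is_derive_zero_const (fun s => g (x + u * s) (y + v * s)) eps);
  [f_equal; ring | | easy].
intros s Hs; destruct (Hg s Hs) as [Hd E].
rewrite <- E; now apply is_derive_along_line.
Qed.

(** * Baire's theorem in the plane *)

Lemma nested_intervals_common_point (l r : nat -> R) :
  (forall n m, l n <= r m) -> exists c, forall n, l n <= c <= r n.
Proof.
intros H.
destruct (completeness (fun c => exists n, c = l n)) as [c [Hub Hlub]].
- exists (r 0%nat); intros c [n ->]; apply H.
- now exists (l 0%nat), 0%nat.
- exists c; intros n; split; [apply Hub; now exists n |].
  apply Hlub; intros d [m ->]; apply H.
Qed.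

(** Nested closed squares, the first one inside the neighbourhood where [P] holds. A common point
    exists by nested intervals in each coordinate, so the radii need not tend to 0. *)
Lemma baire_plane (F : nat -> R * R -> Prop) :
  (forall n, ~ exists p, interior_point (closure (F n)) p) ->
  forall P x0 y0, locally_2d P x0 y0 ->
  exists x y, P x y /\ forall n, ~ F n (x, y).
Proof.
intros HF P x0 y0 [e0 He0].
set (inside := fun (s : R * R * posreal) u v =>
  Rabs (u - fst (fst s)) < snd s /\ Rabs (v - snd (fst s)) < snd s).
set (inside_closed := fun (s : R * R * posreal) u v =>
  Rabs (u - fst (fst s)) <= snd s /\ Rabs (v - snd (fst s)) <= snd s).
(* Each square [s'] avoids one more [F n] and is contained in its predecessor. *)
assert (Hstep : forall (ns : nat * (R * R * posreal)), exists s',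
  forall u v, inside_closed s' u v ->
    inside (snd ns) u v /\ ~ F (fst ns) (u, v)).
{ intros [n [[x y] e]]; simpl.
  (* The open square is not contained in the closure of [F n], since that closure has no interior
     point. *)
  destruct (not_all_not_ex _ (fun q : R * R => inside (x, y, e) (fst q) (snd q)
      /\ ~ closure (F n) q)) as [[x1 y1] [[Hx Hy] Hq]].
  { intros HN; apply (HF n); exists (x, y), e; intros q [Hq1 Hq2].
    apply NNPP; intros Hc; apply (HN q); split; [split |]; assumption. }
  simpl in Hx, Hy.
  assert (Hd : exists d : posreal, forall u v,
    Rabs (u - x1) < d -> Rabs (v - y1) < d -> ~ F n (u, v)).
  { apply NNPP; intros HN; apply Hq; intros U [d Hd].
    apply NNPP; intros HU; apply HN; exists d; intros u v Hu Hv Huv.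
    apply HU; exists (u, v); split; [apply Hd; now split | easy]. }
  destruct Hd as [d Hd].
  (* The bound [d / 2] keeps the closed square away from [F n]; the other two keep it strictly
     inside the previous open square. *)
  assert (He : 0 < Rmin (d / 2)
    (Rmin ((e - Rabs (x1 - x)) / 2) ((e - Rabs (y1 - y)) / 2))).
  { pose proof (cond_pos d); repeat apply Rmin_glb_lt; lra. }
  exists (x1, y1, mkposreal _ He); unfold inside, inside_closed; simpl.
  intros u v [Hu Hv].
  pose proof (cond_pos d).
  pose proof (Rmin_l (d / 2)
    (Rmin ((e - Rabs (x1 - x)) / 2) ((e - Rabs (y1 - y)) / 2))).
  pose proof (Rmin_r (d / 2)
    (Rmin ((e - Rabs (x1 - x)) / 2) ((e - Rabs (y1 - y)) / 2))).
  pose proof (Rmin_l ((e - Rabs (x1 - x)) / 2) ((e - Rabs (y1 - y)) / 2)).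
  pose proof (Rmin_r ((e - Rabs (x1 - x)) / 2) ((e - Rabs (y1 - y)) / 2)).
  repeat split.
  - replace (u - x) with ((u - x1) + (x1 - x)) by ring.
    eapply Rle_lt_trans; [apply Rabs_triang | lra].
  - replace (v - y) with ((v - y1) + (y1 - y)) by ring.
    eapply Rle_lt_trans; [apply Rabs_triang | lra].
  - apply Hd; lra. }
destruct (choice _ Hstep) as [next Hnext].
set (s := fix s n := match n with O => (x0, y0, e0) | S m => next (m, s m) end).
assert (Hs : forall n u v, inside_closed (s (S n)) u v ->
  inside (s n) u v /\ ~ F n (u, v)) by (intros n; apply (Hnext (n, s n))).
assert (Hnest : forall n k u v,
  inside_closed (s (n + k)%nat) u v -> inside_closed (s n) u v).
{ intros n k; induction k as [| k IH]; intros u v Huv.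
  - now rewrite Nat.add_0_r in Huv.
  - rewrite Nat.add_succ_r in Huv; apply IH.
    destruct (Hs _ _ _ Huv) as [[H1 H2] _]; split; now apply Rlt_le. }
(* The centre of the later square lies in both squares, so every left endpoint is at most every
   right endpoint. *)
assert (Hcommon : forall n m, exists u v,
  inside_closed (s n) u v /\ inside_closed (s m) u v).
{ intros n m; set (c := s (Nat.max n m)).
  exists (fst (fst c)), (snd (fst c)).
  assert (Hc : inside_closed c (fst (fst c)) (snd (fst c))).
  { pose proof (cond_pos (snd c)); unfold inside_closed.
    rewrite !Rminus_diag, Rabs_R0; lra. }
  split.
  - apply (Hnest n (Nat.max n m - n)%nat).
    now replace (n + _)%nat with (Nat.max n m) by lia.
  - apply (Hnest m (Nat.max n m - m)%nat).
    now replace (m + _)%nat with (Nat.max n m) by lia. }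
destruct (nested_intervals_common_point
  (fun n => fst (fst (s n)) - snd (s n)) (fun n => fst (fst (s n)) + snd (s n)))
  as [x Hx].
{ intros n m; destruct (Hcommon n m) as (u & v & [Hn _] & [Hm _]).
  apply Rabs_le_between in Hn, Hm; lra. }
destruct (nested_intervals_common_point
  (fun n => snd (fst (s n)) - snd (s n)) (fun n => snd (fst (s n)) + snd (s n)))
  as [y Hy].
{ intros n m; destruct (Hcommon n m) as (u & v & [_ Hn] & [_ Hm]).
  apply Rabs_le_between in Hn, Hm; lra. }
assert (Hxy : forall n, inside_closed (s n) x y).
{ intros n; specialize (Hx n); specialize (Hy n).
  split; apply Rabs_le_between; lra. }
exists x, y; split.
- destruct (Hs 0%nat x y (Hxy 1%nat)) as [[H1 H2] _]; now apply He0.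
- intros n; apply (Hs n x y (Hxy (S n))).
Qed.

(** * Differentiability and symmetry of mixed derivatives *)

Lemma differentiable_pt_lim_C1 (g : R -> R -> R) (x y : R) :
  locally_2d (ex_diff_n g 1) x y ->
  differentiable_pt_lim g x y
    (Derive (fun z => g z y) x) (Derive (fun z => g x z) y).
Proof.
intros H; apply filterdiff_differentiable_pt_lim.
pose proof (locally_2d_singleton _ _ _ H) as (_ & _ & Hy & [Hc _] & _).
apply (is_derive_filterdiff g x y (fun u v => Derive (fun z => g z v) u)).
- apply locally_2d_locally in H; revert H.
  apply filter_imp; intros [u v] (_ & Hu & _); now apply Derive_correct.
- now apply Derive_correct.
- now apply continuity_2d_pt_filterlim in Hc.
Qed.

Lemma Schwarz_C2 (g : R -> R -> R) (x y : R) :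
  locally_2d (ex_diff_n g 2) x y ->
  Derive (fun u => Derive (fun v => g u v) y) x
  = Derive (fun v => Derive (fun u => g u v) x) y.
Proof.
intros H; pose proof (locally_2d_singleton _ _ _ H) as Hxy.
destruct Hxy
  as (_ & _ & _ & (_ & _ & _ & _ & [Hc1 _]) & (_ & _ & _ & [Hc2 _] & _)).
apply Schwarz; [| assumption ..].
destruct H as [d Hd]; exists d; intros u v Hu Hv.
destruct (Hd u v Hu Hv) as (_ & H1 & H2 & (_ & _ & H3 & _) & (_ & H4 & _)).
now repeat split.
Qed.

Lemma locally_2d_open (U : R -> R -> Prop) (P : R -> R -> Prop) (x y : R) :
  (forall u v, U u v -> locally_2d U u v) ->
  (forall u v, U u v -> P u v) -> U x y -> locally_2d P x y.
Proof.
intros HU HP Hxy; destruct (HU x y Hxy) as [d Hd]; exists d.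
intros u v Hu Hv; now apply HP, Hd.
Qed.

(** The symmetry of mixed derivatives is built in: one [fxy] serves both [fx] and [fy], and likewise
    at third order. Abstract functions instead of derivatives of one [f] let the coordinates be
    exchanged. *)
Definition gradient_jet (U : R -> R -> Prop)
    (fx fy fxx fxy fyy fxxx fxxy fxyy fyyy : R -> R -> R) : Prop :=
  forall x y, U x y ->
    (differentiable_pt_lim fx x y (fxx x y) (fxy x y) /\
     differentiable_pt_lim fy x y (fxy x y) (fyy x y)) /\
    (differentiable_pt_lim fxx x y (fxxx x y) (fxxy x y) /\
     differentiable_pt_lim fxy x y (fxxy x y) (fxyy x y) /\
     differentiable_pt_lim fyy x y (fxyy x y) (fyyy x y)) /\
    (continuity_2d_pt fxxx x y /\ continuity_2d_pt fxxy x y /\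
     continuity_2d_pt fxyy x y /\ continuity_2d_pt fyyy x y).

(** Reduces the case of nonzero [fyy] to that of nonzero [fxx]. *)
Lemma gradient_jet_swap U fx fy fxx fxy fyy fxxx fxxy fxyy fyyy :
  let swap {A} (g : R -> R -> A) := fun x y => g y x in
  gradient_jet U fx fy fxx fxy fyy fxxx fxxy fxyy fyyy ->
  gradient_jet (swap U) (swap fy) (swap fx) (swap fyy) (swap fxy) (swap fxx)
    (swap fyyy) (swap fxyy) (swap fxxy) (swap fxxx).
Proof.
intros swap H x y Hxy.
destruct (H y x Hxy) as
  ((H1 & H2) & (H3 & H4 & H5) & (H6 & H7 & H8 & H9)).
repeat split; first [now apply differentiable_pt_lim_swap |
  now intros eps; apply (locally_2d_swap (fun u v => Rabs (_ u v - _ y x) < eps))].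
Qed.

Lemma C3_gradient_jet (U : R -> R -> Prop) (f : R -> R -> R) :
  (forall x y, U x y -> locally_2d U x y) ->
  (forall x y, U x y -> ex_diff_n f 3 x y) ->
  gradient_jet U (partial_derive 1 0 f) (partial_derive 0 1 f)
    (partial_derive 2 0 f) (partial_derive 1 1 f) (partial_derive 0 2 f)
    (partial_derive 1 0 (partial_derive 2 0 f))
    (partial_derive 0 1 (partial_derive 2 0 f))
    (partial_derive 1 0 (partial_derive 0 2 f))
    (partial_derive 0 1 (partial_derive 0 2 f)).
Proof.
intros HU Hf.
set (dx := fun (g : R -> R -> R) x y => Derive (fun z => g z y) x).
set (dy := fun (g : R -> R -> R) x y => Derive (fun z => g x z) y).
change (gradient_jet U (dx f) (dy f) (dx (dx f)) (dx (dy f)) (dy (dy f))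
  (dx (dx (dx f))) (dy (dx (dx f))) (dx (dy (dy f))) (dy (dy (dy f)))).
assert (Hdx : forall n g, (forall x y, U x y -> ex_diff_n g (S n) x y) ->
  forall x y, U x y -> ex_diff_n (dx g) n x y)
  by (intros n g H x y Hxy; now apply ex_diff_n_deriv_aux1, H).
assert (Hdy : forall n g, (forall x y, U x y -> ex_diff_n g (S n) x y) ->
  forall x y, U x y -> ex_diff_n (dy g) n x y)
  by (intros n g H x y Hxy; now apply ex_diff_n_deriv_aux2, H).
assert (Hweak : forall n m g, (m <= n)%nat ->
  (forall x y, U x y -> ex_diff_n g n x y) ->
  forall x y, U x y -> ex_diff_n g m x y)
  by (intros n m g Hm H x y Hxy; now apply (ex_diff_n_m n), H).
assert (Hdiff : forall g, (forall x y, U x y -> ex_diff_n g 1 x y) ->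
  forall x y, U x y -> differentiable_pt_lim g x y (dx g x y) (dy g x y))
  by (intros g H x y Hxy;
      now apply differentiable_pt_lim_C1, (locally_2d_open U)).
assert (Hcont : forall g, (forall x y, U x y -> ex_diff_n g 0 x y) ->
  forall x y, U x y -> continuity_2d_pt g x y)
  by (intros g H x y Hxy; now apply H).
assert (Hsym : forall g, (forall x y, U x y -> ex_diff_n g 2 x y) ->
  forall x y, U x y -> dx (dy g) x y = dy (dx g) x y)
  by (intros g H x y Hxy; now apply Schwarz_C2, (locally_2d_open U)).
(* The equality is needed on a neighbourhood because it will be differentiated in [x]. *)
assert (Hfxy : forall x y, U x y -> locally_2d
    (fun u v => dx (dy f) u v = dy (dx f) u v) x y).
{ intros x y Hxy; apply (locally_2d_open U); try easy.
  now apply Hsym, (Hweak 3%nat); [lia |]. }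
intros x y Hxy; repeat split.
- rewrite (Hsym f); [| apply (Hweak 3%nat); [lia | easy] | easy].
  apply Hdiff; [| easy]; apply (Hweak 2%nat); [lia |]; now apply Hdx.
- apply Hdiff; [| easy]; apply (Hweak 2%nat); [lia |]; now apply Hdy.
- apply Hdiff; [| easy]; now apply Hdx, Hdx.
(* The derivatives of [fxy] must be named as those of [fxx] and [fyy]: symmetry is used for [dy f],
   for [dx f], and for [f] under one more [dx]. *)
- replace (dy (dx (dx f)) x y) with (dx (dx (dy f)) x y).
  + replace (dx (dy (dy f)) x y) with (dy (dx (dy f)) x y).
    * apply Hdiff; [| easy]; now apply Hdx, Hdy.
    * symmetry; apply Hsym; [now apply Hdy | easy].
  + transitivity (dx (dy (dx f)) x y).
    * apply Derive_ext_loc.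
      apply (locally_2d_1d_const_y _ x y (Hfxy x y Hxy)).
    * apply Hsym; [now apply Hdx | easy].
- apply Hdiff; [| easy]; now apply Hdy, Hdy.
- apply Hcont; [| easy]; now apply Hdx, Hdx, Hdx.
- apply Hcont; [| easy]; now apply Hdy, Hdx, Hdx.
- apply Hcont; [| easy]; now apply Hdx, Hdy, Hdy.
- apply Hcont; [| easy]; now apply Hdy, Hdy, Hdy.
Qed.

(** * Segments of constant gradient when the Hessian determinant vanishes *)

Definition constant_along_segment (U : R -> R -> Prop) (g h : R -> R -> R)
    (x y : R) : Prop :=
  exists (u v : R) (eps : posreal), (u, v) <> (0, 0) /\
    forall t, - eps < t < eps -> U (x + u * t) (y + v * t) /\
      g (x + u * t) (y + v * t) = g x y /\ h (x + u * t) (y + v * t) = h x y.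

(** Product rule along the horizontal line through the point: since [U] is open,
    [fxx * fyy - fxy ^ 2] is identically 0 on a short piece of this line. *)
Lemma hessian_det_derive_x U fx fy fxx fxy fyy fxxx fxxy fxyy fyyy x y :
  (forall u v, U u v -> locally_2d U u v) ->
  gradient_jet U fx fy fxx fxy fyy fxxx fxxy fxyy fyyy ->
  (forall u v, U u v -> fxx u v * fyy u v = fxy u v ^ 2) ->
  U x y ->
  fxxx x y * fyy x y + fxx x y * fxyy x y = 2 * fxy x y * fxxy x y.
Proof.
intros HU Hjet Hdet Hxy.
assert (Hline : forall g gx gy, differentiable_pt_lim g x y gx gy ->
  is_derive (fun s => g (x + 1 * s) (y + 0 * s)) 0 gx).
{ intros g gx gy Hg; replace gx with (gx * 1 + gy * 0) by ring.
  apply is_derive_along_line.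
  now replace (x + 1 * 0) with x by ring; replace (y + 0 * 0) with y by ring. }
destruct (Hjet x y Hxy) as (_ & (Hxx & Hxyd & Hyy) & _).
apply Hline in Hxx, Hxyd, Hyy.
set (a := fun s => fxx (x + 1 * s) (y + 0 * s)) in *.
set (b := fun s => fxy (x + 1 * s) (y + 0 * s)) in *.
set (c := fun s => fyy (x + 1 * s) (y + 0 * s)) in *.
assert (Hd : is_derive (fun s => a s * c s - b s ^ 2) 0
  (fxxx x y * c 0 + a 0 * fxyy x y - 2 * b 0 * fxxy x y)).
{ auto_derive.
  - now repeat split; eexists; eassumption.
  - rewrite (is_derive_unique a _ _ Hxx : Derive (fun s : R => a s) 0 = _).
    rewrite (is_derive_unique b _ _ Hxyd : Derive (fun s : R => b s) 0 = _).
    rewrite (is_derive_unique c _ _ Hyy : Derive (fun s : R => c s) 0 = _).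
    ring. }
apply is_derive_unique in Hd.
rewrite (Derive_ext_loc _ (fun _ => 0)), Derive_const in Hd.
- unfold a, b, c in Hd.
  replace (x + 1 * 0) with x in Hd by ring.
  replace (y + 0 * 0) with y in Hd by ring.
  lra.
- destruct (locally_2d_along_line U x y 1 0 (HU x y Hxy)) as [eps Heps].
  exists eps; intros s Hs.
  unfold ball in Hs; simpl in Hs; unfold AbsRing_ball, abs, minus, plus, opp in Hs.
  simpl in Hs; rewrite Ropp_0, Rplus_0_r in Hs; apply Rabs_def2 in Hs.
  unfold a, b, c; rewrite Hdet; [ring | apply Heps; lra].
Qed.

Lemma gradient_constant_along_segment_xx
    U fx fy fxx fxy fyy fxxx fxxy fxyy fyyy x0 y0 :
  (forall u v, U u v -> locally_2d U u v) ->
  gradient_jet U fx fy fxx fxy fyy fxxx fxxy fxyy fyyy ->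
  (forall u v, U u v -> fxx u v * fyy u v = fxy u v ^ 2) ->
  U x0 y0 -> fxx x0 y0 <> 0 -> constant_along_segment U fx fy x0 y0.
Proof.
intros HU Hjet Hdet Hxy0 Hnz.
(* The constant slope at the base point, called [l0] in the overview. *)
set (l := fxy x0 y0 / fxx x0 y0).
(* [k] is the derivative of [fxy / fxx] in its first variable. *)
set (k := fun u v =>
  (fxxy u v * fxx u v - fxy u v * fxxx u v) * / (fxx u v * fxx u v)).
assert (Hcont : forall u v, U u v ->
  continuity_2d_pt fxx u v /\ continuity_2d_pt fxy u v).
{ intros u v Huv; destruct (Hjet u v Huv) as (_ & (H1 & H2 & _) & _).
  split; apply differentiable_continuity_pt; eexists; eexists; eassumption. }
destruct (Hcont x0 y0 Hxy0) as [Cxx Cxy].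
assert (Ck : continuity_2d_pt k x0 y0).
{ destruct (Hjet x0 y0 Hxy0) as (_ & _ & (Cxxx & Cxxy & _)).
  apply continuity_2d_pt_mult.
  - now apply continuity_2d_pt_minus; apply continuity_2d_pt_mult.
  - apply continuity_2d_pt_inv; [now apply continuity_2d_pt_mult |].
    now apply Rmult_integral_contrapositive. }
(* Near the point [k] stays within 1 of its value there; this gives the bound [Rabs (k x0 y0) + 1]
   for the linear equation. *)
assert (Hloc : locally_2d (fun u v => (U u v /\ fxx u v <> 0) /\
    Rabs (k u v - k x0 y0) < 1) x0 y0).
{ apply locally_2d_and; [apply locally_2d_and |].
  - now apply HU.
  - now apply continuity_2d_pt_neq_0.
  - apply (Ck (mkposreal 1 Rlt_0_1)). }
destruct (locally_2d_along_line _ _ _ (- l) 1 Hloc) as [eps Heps]; clear Hloc.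
assert (Hline : forall g gx gy t, - eps < t < eps ->
  differentiable_pt_lim g (x0 + - l * t) (y0 + 1 * t) gx gy ->
  is_derive (fun s => g (x0 + - l * s) (y0 + 1 * s)) t (gy - l * gx)).
{ intros g gx gy t Ht Hg; replace (gy - l * gx) with (gx * - l + gy * 1) by ring.
  now apply is_derive_along_line. }
assert (Hl : forall t, - eps < t < eps ->
  fxy (x0 + - l * t) (y0 + 1 * t) / fxx (x0 + - l * t) (y0 + 1 * t) - l = 0).
{ apply (linear_ode_zero _
    (fun t => k (x0 + - l * t) (y0 + 1 * t)) eps (Rabs (k x0 y0) + 1)).
  - intros t Ht; destruct (Heps t Ht) as [[HUt Hnzt] _].
    pose proof (hessian_det_derive_x _ _ _ _ _ _ _ _ _ _ _ _ HU Hjet Hdet HUt)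
      as Hdetx.
    pose proof (Hdet _ _ HUt) as Hdett.
    destruct (Hjet _ _ HUt) as (_ & (Hxx & Hxyd & _) & _).
    apply Hline in Hxx, Hxyd; try easy.
    unfold k.
    set (a := fun s => fxx (x0 + - l * s) (y0 + 1 * s)) in *.
    set (b := fun s => fxy (x0 + - l * s) (y0 + 1 * s)) in *.
    change (is_derive (fun s => b s / a s - l) t
      ((fxxy (x0 + - l * t) (y0 + 1 * t) * a t
        - b t * fxxx (x0 + - l * t) (y0 + 1 * t)) * / (a t * a t)
        * (b t / a t - l))).
    fold (a t) in Hnzt, Hdetx, Hdett; fold (b t) in Hdetx, Hdett.
    auto_derive.
    + repeat split; [eexists; eassumption .. | easy].
    + rewrite (is_derive_unique a _ _ Hxx : Derive (fun s : R => a s) t = _).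
      rewrite (is_derive_unique b _ _ Hxyd : Derive (fun s : R => b s) t = _).
      set (A := fxxx _ _) in *; set (B := fxxy _ _) in *.
      set (C := fxyy _ _) in *; set (c := fyy _ _) in *.
      (* The vanishing determinant eliminates [fyy], its [x]-derivative eliminates [fxyy]; what
         remains is Burgers' equation as a rational identity. *)
      assert (Ec : c = b t ^ 2 / a t) by (rewrite <- Hdett; field; easy).
      assert (EC : C = (2 * b t * B - A * c) / a t)
        by (rewrite <- Hdetx; field; easy).
      rewrite EC, Ec; field; easy.
  - intros t Ht; destruct (Heps t Ht) as [_ Hk].
    pose proof (Rabs_triang_inv (k (x0 + - l * t) (y0 + 1 * t)) (k x0 y0)); lra.
  - replace (x0 + - l * 0) with x0 by ring; replace (y0 + 1 * 0) with y0 by ring.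
    unfold l; ring. }
exists (- l), 1, eps; split; [injection; lra |].
assert (Hl' : forall t, - eps < t < eps -> fxy (x0 + - l * t) (y0 + 1 * t)
    = l * fxx (x0 + - l * t) (y0 + 1 * t)).
{ intros t Ht; rewrite <- (Rminus_diag_uniq _ _ (Hl t Ht)) at 2.
  field; apply (Heps t Ht). }
intros t Ht; split; [apply (Heps t Ht) | split].
- apply (constant_along_line fx fxx fxy _ _ _ _ eps); [| easy].
  intros s Hs X Y; split; [apply (Hjet X Y), (Heps s Hs) |].
  unfold X, Y; rewrite Hl' by easy; ring.
- apply (constant_along_line fy fxy fyy _ _ _ _ eps); [| easy].
  intros s Hs X Y; destruct (Heps s Hs) as [[HUs Hnzs] _].
  split; [now apply (Hjet X Y) |].
  (* Multiplied by [fxx], the derivative of [fy] along the line is [fxx * fyy - fxy * (l * fxx)],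
     and both products equal [fxy ^ 2]. *)
  apply (Rmult_eq_reg_l (fxx X Y)); [| easy].
  transitivity (fxx X Y * fyy X Y - fxy X Y * (l * fxx X Y)); [ring |].
  unfold X, Y; rewrite Hdet, <- Hl' by easy; ring.
Qed.

Lemma gradient_constant_along_segment
    U fx fy fxx fxy fyy fxxx fxxy fxyy fyyy x0 y0 :
  (forall u v, U u v -> locally_2d U u v) ->
  gradient_jet U fx fy fxx fxy fyy fxxx fxxy fxyy fyyy ->
  (forall u v, U u v -> fxx u v * fyy u v = fxy u v ^ 2) ->
  U x0 y0 ->
  ~ (fxx x0 y0 = 0 /\ fxy x0 y0 = 0 /\ fyy x0 y0 = 0) \/
  locally_2d (fun u v => fxx u v = 0 /\ fxy u v = 0 /\ fyy u v = 0) x0 y0 ->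
  constant_along_segment U fx fy x0 y0.
Proof.
intros HU Hjet Hdet Hxy0 [Hnz | Hz].
- destruct (Req_dec (fxx x0 y0) 0) as [Exx | Nxx].
  (* If [fxx = 0], the determinant forces [fxy = 0], so the nonzero Hessian has [fyy] nonzero and
     the exchanged coordinates apply. *)
  + destruct (gradient_constant_along_segment_xx _ _ _ _ _ _ _ _ _ _ y0 x0
      (fun u v Huv => locally_2d_swap _ _ _ (HU v u Huv))
      (gradient_jet_swap _ _ _ _ _ _ _ _ _ _ Hjet)) as (u & v & eps & Huv & H).
    * intros u v Huv; rewrite Rmult_comm; now apply Hdet.
    * easy.
    * intros Eyy; apply Hnz; repeat split; try easy.
      pose proof (Hdet x0 y0 Hxy0) as E; rewrite Exx in E.
      apply Rsqr_0_uniq; rewrite Rsqr_pow2; lra.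
    * exists v, u, eps; split.
      -- intros E; injection E; intros; apply Huv; now subst.
      -- intros t Ht; destruct (H t Ht) as (H1 & H2 & H3); now repeat split.
  + now apply (gradient_constant_along_segment_xx U fx fy fxx fxy fyy
      fxxx fxxy fxyy fyyy).
- destruct (locally_2d_along_line _ x0 y0 1 0
    (locally_2d_and _ _ _ _ (HU x0 y0 Hxy0) Hz)) as [eps Heps].
  exists 1, 0, eps; split; [injection; lra |].
  intros t Ht; split; [apply (Heps t Ht) | split].
  + apply (constant_along_line fx fxx fxy _ _ _ _ eps); [| easy].
    intros s Hs X Y; destruct (Heps s Hs) as (HUs & Exx & Exy & _).
    split; [now apply (Hjet X Y) |]; unfold X, Y; rewrite Exx, Exy; ring.
  + apply (constant_along_line fy fxy fyy _ _ _ _ eps); [| easy].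
    intros s Hs X Y; destruct (Heps s Hs) as (HUs & _ & Exy & Eyy).
    split; [now apply (Hjet X Y) |]; unfold X, Y; rewrite Exy, Eyy; ring.
Qed.

(** * The exceptional set *)

(** The set itself is nowhere dense, so a constant sequence witnesses negligibility. If its closure
    contained a neighbourhood, relative closedness of [Z] would put [Z] around some point of the
    set, against the definition of the set. *)
Lemma frontier_negligible (U Z : R -> R -> Prop) :
  (forall x y, U x y -> locally_2d U x y) ->
  (forall x y, U x y -> ~ Z x y -> locally_2d (fun u v => ~ Z u v) x y) ->
  negligible (fun p : R * R => U (fst p) (snd p) /\ Z (fst p) (snd p) /\
    ~ locally_2d Z (fst p) (snd p)).
Proof.
intros HU HZ.
set (A := fun p : R * R => _).
exists (fun _ => A); split; [| intros p; split; [now exists 0%nat | now intros [_ H]]].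
intros _ [p Hp].
(* An interior point of the closure has points of [A] arbitrarily near; one of them is again
   interior to the closure. *)
destruct (locally_singleton _ _ Hp _ (locally_locally _ _ Hp))
  as ([x y] & Hcl & HUxy & _ & HnZ).
apply HnZ.
pose proof (locally_2d_and _ (fun u v => closure A (u, v)) _ _ (HU x y HUxy)) as H.
destruct H as [d Hd].
- apply locally_2d_locally; revert Hcl; apply filter_imp; now intros [u v].
- exists d; intros u v Hu Hv; destruct (Hd u v Hu Hv) as [HUuv Huv].
  apply NNPP; intros Hn.
  pose proof (HZ u v HUuv Hn) as Hloc; apply locally_2d_locally in Hloc.
  now destruct (Huv _ Hloc) as ([u' v'] & Hn' & _ & HZ' & _).
Qed.

(** * Tangent planes along segments *)

(** With constant gradient, [f] is affine of slope [w] along the segment, so the lifted segment lies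
    in the graph; tangent planes with equal gradients that share this segment coincide. *)
Lemma tangent_along_of_constant_gradient (D : point2 -> Prop) (f : R -> R -> R)
    (x y : R) :
  (forall u v, D (u, v) -> differentiable_pt_lim f u v
    (partial_derive 1 0 f u v) (partial_derive 0 1 f u v)) ->
  constant_along_segment (fun u v => D (u, v))
    (partial_derive 1 0 f) (partial_derive 0 1 f) x y ->
  exists S, segment_through (x, y, f x y) S /\
    tangent_along D f (tangent_plane f x y) S.
Proof.
intros Hf (u & v & eps & Huv & H).
set (w := partial_derive 1 0 f x y * u + partial_derive 0 1 f x y * v).
assert (Hw : forall t, - eps < t < eps ->
  f (x + u * t) (y + v * t) = f x y + w * t).
{ intros t Ht.
  set (a := fun s => f (x + u * s) (y + v * s)).
  enough (a t - w * t = a 0 - w * 0) as E.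
  { unfold a in E at 2; rewrite !Rmult_0_r, !Rplus_0_r in E.
    unfold a in E; lra. }
  apply (is_derive_zero_const (fun s => a s - w * s) eps); [| easy].
  intros s Hs; destruct (H s Hs) as (HD & E1 & E2).
  pose proof (is_derive_along_line f x y u v s _ _ (Hf _ _ HD)) as Ha.
  rewrite E1, E2 in Ha; fold a w in Ha.
  auto_derive; [now exists w |].
  rewrite (is_derive_unique a s _ Ha : Derive (fun s : R => a s) s = _); ring. }
exists (fun Q => exists t, - eps < t < eps /\
  Q = (x + u * t, y + v * t, f x y + w * t)).
split; [| split].
- exists u, v, w, eps; split; [| easy].
  intros E; apply Huv; now injection E as -> -> _.
- intros P (t & Ht & ->); split; [apply (H t Ht) | now rewrite Hw].
- intros P (t & Ht & ->) [[X Y] Z]; simpl.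
  destruct (H t Ht) as (_ & E1 & E2).
  unfold tangent_plane; rewrite E1, E2, Hw by easy; unfold w.
  split; intros ->; ring.
Qed.

(** A common tangent plane means a constant gradient; differentiating along the segment puts its
    direction in the kernel of the Hessian. *)
Lemma hessian_det_0_of_tangent_along (D : point2 -> Prop) (f : R -> R -> R)
    (x y fxx fxy fyy : R) :
  differentiable_pt_lim (partial_derive 1 0 f) x y fxx fxy ->
  differentiable_pt_lim (partial_derive 0 1 f) x y fxy fyy ->
  (exists S, segment_through (x, y, f x y) S /\
    tangent_along D f (tangent_plane f x y) S) ->
  fxx * fyy - fxy ^ 2 = 0.
Proof.
intros Hfx Hfy (S & (u & v & w & eps & Hne & HS) & Hgraph & Htan).
assert (HSt : forall t, - eps < t < eps ->
  S (x + u * t, y + v * t, f x y + w * t)) by (intros t Ht; apply HS; now exists t).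
(* The segment is not vertical: a graph has one point over [(x, y)], so [u = v = 0] would give
   [w = 0], as seen at [t = eps / 2]. *)
assert (Huv : (u, v) <> (0, 0)).
{ intros E; injection E as Eu Ev; apply Hne; subst u v.
  pose proof (cond_pos eps).
  destruct (Hgraph _ (HSt (eps / 2) ltac:(lra))) as [_ E].
  rewrite !Rmult_0_l, !Rplus_0_r in E.
  replace w with 0; [easy |].
  apply (Rmult_eq_reg_r (eps / 2)); lra. }
assert (Hgrad : forall t, - eps < t < eps ->
  partial_derive 1 0 f (x + u * t) (y + v * t) = partial_derive 1 0 f x y /\
  partial_derive 0 1 f (x + u * t) (y + v * t) = partial_derive 0 1 f x y).
{ intros t Ht; pose proof (Htan _ (HSt t Ht)) as Hpl.
  unfold is_tangent_plane_at in Hpl.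
  assert (Heq : forall X Y,
    f x y + partial_derive 1 0 f x y * (X - x) + partial_derive 0 1 f x y * (Y - y)
    = f (x + u * t) (y + v * t)
      + partial_derive 1 0 f (x + u * t) (y + v * t) * (X - (x + u * t))
      + partial_derive 0 1 f (x + u * t) (y + v * t) * (Y - (y + v * t)))
    by (intros X Y; now apply (proj1 (Hpl (X, Y, _)))).
  (* Two affine functions that agree at these three points have the same coefficients. *)
  pose proof (Heq 0 0); pose proof (Heq 1 0); pose proof (Heq 0 1); split; lra. }
assert (Hker : forall g gx gy, differentiable_pt_lim g x y gx gy ->
  (forall t, - eps < t < eps -> g (x + u * t) (y + v * t) = g x y) ->
  gx * u + gy * v = 0).
{ intros g gx gy Hg Hc.
  assert (Hd : is_derive (fun s => g (x + u * s) (y + v * s)) 0 (gx * u + gy * v))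
    by (apply is_derive_along_line; now rewrite !Rmult_0_r, !Rplus_0_r).
  apply is_derive_unique in Hd; rewrite <- Hd.
  rewrite (Derive_ext_loc _ (fun _ => g x y)); [apply Derive_const |].
  apply (locally_interval _ 0 (- eps) eps);
    try (simpl; pose proof (cond_pos eps); lra).
  intros s H1 H2; apply Hc; now split. }
pose proof (Hker _ _ _ Hfx (fun t Ht => proj1 (Hgrad t Ht))) as E1.
pose proof (Hker _ _ _ Hfy (fun t Ht => proj2 (Hgrad t Ht))) as E2.
(* Multiplying the kernel equations by the adjugate matrix gives the determinant times each
   component of the direction. *)
assert (Hu : (fxx * fyy - fxy ^ 2) * u = 0).
{ replace (_ * u) with (fyy * (fxx * u + fxy * v) - fxy * (fxy * u + fyy * v)) by ring.
  rewrite E1, E2; ring. }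
assert (Hv : (fxx * fyy - fxy ^ 2) * v = 0).
{ replace (_ * v) with (fxx * (fxy * u + fyy * v) - fxy * (fxx * u + fxy * v)) by ring.
  rewrite E1, E2; ring. }
apply Rmult_integral in Hu, Hv.
destruct Hu as [| ->]; [easy |]; destruct Hv as [| ->]; [easy |].
now destruct Huv.
Qed.

(** * Openness of the disk and the equivalence *)

Lemma open_disk_open (a b r x y : R) :
  open_disk a b r (x, y) -> locally_2d (fun u v => open_disk a b r (u, v)) x y.
Proof.
unfold open_disk; simpl; intros H.
set (g := fun u v => (u - a) * (u - a) + (v - b) * (v - b)).
assert (Hg : continuity_2d_pt g x y).
{ apply continuity_2d_pt_plus; apply continuity_2d_pt_mult;
    apply continuity_2d_pt_minus;
    first [apply continuity_2d_pt_id1 | apply continuity_2d_pt_id2 |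
           apply continuity_2d_pt_const]. }
assert (He : 0 < r * (r * 1) - g x y) by (unfold g; lra).
destruct (Hg (mkposreal _ He)) as [d Hd]; exists d; intros u v Hu Hv.
specialize (Hd u v Hu Hv); apply Rabs_def2 in Hd; simpl in Hd.
unfold g in Hd; lra.
Qed.

Theorem theorem2 (f : R -> R -> R) (a b r : R) (hr : 0 < r)
    (hf : C_n_on 3 (open_disk a b r) f) :
  at_generic_point (open_disk a b r)
    (fun p : point2 =>
       let '(x, y) := p in
       exists S : point3 -> Prop,
         segment_through (x, y, f x y) S /\
         tangent_along (open_disk a b r) f (tangent_plane f x y) S)
  <->
  (forall x y : R, open_disk a b r (x, y) -> hessian_det f x y = 0).
Proof.
set (U := fun x y => open_disk a b r (x, y)).
assert (HU : forall x y, U x y -> locally_2d U x y) by apply open_disk_open.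
pose proof (C3_gradient_jet U f HU hf) as Hjet.
assert (Hcont : forall x y, U x y ->
  continuity_2d_pt (partial_derive 2 0 f) x y /\
  continuity_2d_pt (partial_derive 1 1 f) x y /\
  continuity_2d_pt (partial_derive 0 2 f) x y).
{ intros x y Hxy; destruct (Hjet x y Hxy) as (_ & (H1 & H2 & H3) & _).
  repeat split; apply differentiable_continuity_pt; eexists; eexists; eassumption. }
split.
- intros (N & (F & HF & HN) & HP) x y Hxy.
  apply NNPP; intros Hdet.
  destruct (Hcont x y Hxy) as (Cxx & Cxy & Cyy).
  assert (Chess : continuity_2d_pt (hessian_det f) x y).
  { apply continuity_2d_pt_minus; [now apply continuity_2d_pt_mult |].
    apply (continuity_2d_pt_mult (partial_derive 1 1 f)); [easy |].
    apply (continuity_2d_pt_mult (partial_derive 1 1 f)); [easy |].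
    apply continuity_2d_pt_const. }
  (* The determinant stays nonzero near [(x, y)], and Baire's theorem finds a point there outside
     [N], where a tangent segment exists. *)
  destruct (baire_plane F HF _ x y (locally_2d_and _ _ x y (HU x y Hxy)
    (continuity_2d_pt_neq_0 _ _ _ Chess Hdet))) as (u & v & [HUuv Hnz] & Huv).
  apply Hnz.
  destruct (Hjet u v HUuv) as ((Hfx & Hfy) & _).
  apply (hessian_det_0_of_tangent_along (open_disk a b r) f u v _ _ _ Hfx Hfy).
  apply (HP (u, v) HUuv); intros HNuv; apply HN in HNuv.
  destruct HNuv as [n Hn]; exact (Huv n Hn).
- intros Hdet.
  set (Z := fun x y => partial_derive 2 0 f x y = 0 /\
    partial_derive 1 1 f x y = 0 /\ partial_derive 0 2 f x y = 0).
  exists (fun p => U (fst p) (snd p) /\ Z (fst p) (snd p) /\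
    ~ locally_2d Z (fst p) (snd p)); split.
  + apply frontier_negligible; [easy |].
    intros x y Hxy HnZ; destruct (Hcont x y Hxy) as (Cxx & Cxy & Cyy).
    (* By continuity, whichever second derivative is nonzero stays nonzero nearby, so [Z] is
       relatively closed. *)
    apply not_and_or in HnZ; destruct HnZ as [Hn | HnZ];
      [| apply not_and_or in HnZ; destruct HnZ as [Hn | Hn]].
    * destruct (continuity_2d_pt_neq_0 _ _ _ Cxx Hn) as [d Hd].
      exists d; intros u v Hu Hv HZ; now apply (Hd u v Hu Hv), HZ.
    * destruct (continuity_2d_pt_neq_0 _ _ _ Cxy Hn) as [d Hd].
      exists d; intros u v Hu Hv HZ; now apply (Hd u v Hu Hv), HZ.
    * destruct (continuity_2d_pt_neq_0 _ _ _ Cyy Hn) as [d Hd].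
      exists d; intros u v Hu Hv HZ; now apply (Hd u v Hu Hv), HZ.
  + intros [x y] Hxy HN.
    apply tangent_along_of_constant_gradient.
    * intros u v Huv; apply (differentiable_pt_lim_C1 f).
      apply (locally_2d_open U); [easy | | easy].
      intros u' v' H; apply (ex_diff_n_m 3); [lia | now apply hf].
    * eapply gradient_constant_along_segment;
        [exact HU | exact Hjet | | exact Hxy |].
      -- intros u v Huv; pose proof (Hdet u v Huv) as E.
         unfold hessian_det in E; lra.
      -- destruct (classic (Z x y)) as [HZ | HnZ]; [right | now left].
         apply NNPP; intros Hloc; now apply HN.
Qed.
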